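(* Let $(X,\mathcal F,T,P)$ be a target problem, let $\mathrm{Str}=(\mathrm{Str}_n)_n$ be a target algorithm with $\mathrm{Str}_n(X,\mathcal F,T,P)=(X,\mathcal F_n,T,P_n)$, and let $\pi$ be the optimal compatible projection associated to $(X,\mathcal F,T,P)$. Then: (i) $\mathcal F_n\subseteq\mathcal F_{n+1}$ for every $n$, and $\vee_n\mathcal F_n=\mathcal F_\pi$; (ii) $\lim_n P_n(x,F)=P_\pi(x,F)$ for every $x\in X$ and every $F\in\cup_m\mathcal F_m$.
   Context: Standing setting. $(X,\mathcal X)$ is a measurable space and $T\in\mathcal X$ is a fixed set (the target). A random variable is a measurable $f:(X,\mathcal X)\to(\mathbb R,\mathcal B_{\mathbb R})$; it is discrete if it takes at most countably many values. $\pi_f$ is the equivalence relation $x\,\pi_f\,y\iff f(x)=f(y)$. Relations are ordered by inclusion as subsets of $X\times X$. It is assumed throughout that $(X,\mathcal X)$ satisfies (A0): for all random variables $f,g$, $\pi_f\subseteq\pi_g$ implies $\sigma(f)\supseteq\sigma(g)$ (so that $\sigma(f)$ is determined by $\pi_f$). An equivalence relation on a measurable space is measurable (discrete) if it equals $\pi_f$ for some (discrete) random variable $f$ on that space. Target problems. For a sub-$\sigma$-algebra $\mathcal F\subseteq\mathcal X$ with $T\in\mathcal F$, a transition probability on $(X,\mathcal F)$ is $P:X\times\mathcal F\to[0,1]$ with $P(x,\cdot)$ a probability measure on $\mathcal F$ for every $x\in X$ and $P(\cdot,F)$ $\mathcal F$-measurable for every $F\in\mathcal F$. A target problem is $(X,\mathcal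 F,T,P)$ with such $\mathcal F,P$; it is simple if $\mathcal F$ is generated by an at most countable partition of $X$. A strategy is a sequence $(\mathrm{Str}_n)_n$ of maps from target problems to simple target problems. Compatible projections. A compatible projection for $(X,\mathcal F,T,P)$ is an equivalence relation of the form $\pi_f$, with $f$ a random variable such that $\sigma(f)\subseteq\mathcal F$ and $T\in\sigma(f)$, satisfying $P(x,F)=P(y,F)$ for all $x,y$ with $x\,\pi_f\,y$ and all $F\in\sigma(f)$. It is optimal if it contains every other compatible projection; a unique optimal compatible projection exists. For a compatible projection $\pi=\pi_f$, $\mathcal F_\pi:=\sigma(f)$ and $P_\pi$ is the transition probability on $(X,\mathcal F_\pi)$ given by $P_\pi(x,F)=P(x,F)$, $x\in X$, $F\in\mathcal F_\pi$. Target algorithms. Let $S=\{p=(p_i)_{i\ge1}: p_i\ge0,\ \sum_i p_i\le1\}\subset\ell_1$ with the $\sigma$-algebra $\mathcal B_S$ induced by the product Borel $\sigma$-algebra of $[0,1]^{\mathbb N}$. An $\epsilon$-equivalence on $S$ is a discrete equivalence $\sim_\epsilon$ on $(S,\mathcal B_S)$ such that $\|p-q\|_1<\epsilon$ whenever $p\sim_\epsilon q$. A target algorithm is a strategy obtained as follows. Choose $\epsilon_n>0$, $\epsilon_n\to0$, and for each $n$ an $\epsilon_n$-equivalence $\sim_{\epsilon_n}$ on $S$. Given $(X,\mathcal F,T,P)$, let $\mathcal F_0=\sigma(T)=\{\varnothing,T,X\setminus T,X\}$ with $\pi_0$ the equivalence with classes $T$, $X\setminus T$. For $n\ge1$, let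 $(A_i^{(n-1)})_i$ be an enumeration of the at most countable partition $X/\pi_{n-1}$ generating $\mathcal F_{n-1}$, and set $x\,\pi_n\,y\iff x\,\pi_{n-1}\,y$ and $(P(x,A_i^{(n-1)}))_i\sim_{\epsilon_n}(P(y,A_i^{(n-1)}))_i$ (finite sequences are extended by zeros), $\mathcal F_n=\sigma(X/\pi_n)$. Choose a probability measure $\mu$ on $\vee_n\mathcal F_n$ with $\mu(F)>0$ for every $n$ and every nonempty $F\in\mathcal F_n$ (such $\mu$ exists). For $F\in\mathcal F_n$ put $Y^F(\omega)=P(\omega,F)$, which is a $\vee_n\mathcal F_n$-measurable random variable, and $P_n(x,F)=\mathbb E_\mu[Y^F\mid\mathcal F_n](x)$ for all $x\in X$, i.e. $P_n(x,F)=\mu([x]_n)^{-1}\int_{[x]_n}P(z,F)\,\mu(dz)$ with $[x]_n$ the $\pi_n$-class of $x$. Then $\mathrm{Str}_n(X,\mathcal F,T,P)=(X,\mathcal F_n,T,P_n)$. In (ii), $P_n(x,F)$ is considered for $n$ large enough that $F\in\mathcal F_n$. *)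

(* Defs.v *)
From HB Require Import structures.
From mathcomp Require Import all_boot all_order all_algebra.
From mathcomp Require Import all_classical all_reals all_analysis.
Set Implicit Arguments.
Unset Strict Implicit.
Unset Printing Implicit Defensive.
Import Order.TTheory GRing.Theory Num.Theory.
Import numFieldNormedType.Exports.
Local Open Scope classical_set_scope.
Local Open Scope ring_scope.

(* Equivalence relations are sets of pairs, so that set inclusion is the order
   on relations and set equality is equality of relations. *)

Definition ker_rel (Y Z : Type) (f : Y -> Z) : set (Y * Y) :=
  [set xy | f xy.1 = f xy.2].

Definition rel_class (Y : Type) (E : set (Y * Y)) (x : Y) : set Y :=
  [set y | E (x, y)].

Definition quotient (Y : Type) (E : set (Y * Y)) : set (set Y) :=
  range (rel_class E).

Definition sigma d (X : measurableType d) (R : realType) (f : X -> R) :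
  set (set X) := g_sigma_algebra_preimage f.

Definition A0 d (X : measurableType d) (R : realType) : Prop :=
  forall f g : X -> R, measurable_fun setT f -> measurable_fun setT g ->
    ker_rel f `<=` ker_rel g -> sigma g `<=` sigma f.

Definition discrete_equiv (R : realType) d (Y : measurableType d)
    (E : set (Y * Y)) : Prop :=
  exists f : Y -> R,
    [/\ measurable_fun setT f, countable (range f) & E = ker_rel f].

(* A kernel from X to X, both equipped with the sigma-algebra [tp_alg], is a
   total function on [set X]; only its values on members of [tp_alg] matter. *)
Record target_problem d (X : measurableType d) (R : realType) (T : set X) :=
  TargetProblem {
    tp_alg : set (set X) ;
    tp_alg_sigma_algebra : sigma_algebra setT tp_alg ;
    tp_alg_measurable : tp_alg `<=` measurable ;
    tp_alg_target : tp_alg T ;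
    tp_prob :
      R.-pker (g_sigma_algebraType tp_alg) ~> (g_sigma_algebraType tp_alg) }.

Definition simple_problem d (X : measurableType d) (R : realType) (T : set X)
    (tp : target_problem R T) : Prop :=
  exists Q : set (set X),
    [/\ countable Q, partition Q id setT & tp_alg tp = <<s Q >>].

Record simple_target_problem d (X : measurableType d) (R : realType)
    (T : set X) := SimpleTargetProblem {
  simple_tp :> target_problem R T ;
  simple_tpP : simple_problem simple_tp }.

Definition strategy d (X : measurableType d) (R : realType) (T : set X) :=
  nat -> target_problem R T -> simple_target_problem R T.

Definition compatible_projection d (X : measurableType d) (R : realType)
    (T : set X) (tp : target_problem R T) (E : set (X * X)) : Prop :=
  exists f : X -> R,
    [/\ measurable_fun setT f, E = ker_rel f,
        sigma f `<=` tp_alg tp, sigma f T &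
        forall x y, E (x, y) ->
          forall A, sigma f A -> tp_prob tp x A = tp_prob tp y A].

Definition optimal_projection d (X : measurableType d) (R : realType)
    (T : set X) (tp : target_problem R T) (E : set (X * X)) : Prop :=
  compatible_projection tp E /\
  forall E', compatible_projection tp E' -> E' `<=` E.

(* The space S of subprobability sequences, indexed from 0. *)
Definition is_subprob (R : realType) (p : nat -> R) : Prop :=
  (forall i, 0 <= p i) /\ (\sum_(0 <= i <oo) (p i)%:E <= 1)%E.

Definition subprob (R : realType) := {p : nat -> R | is_subprob p}.

Lemma is_subprob0 (R : realType) : is_subprob (fun _ : nat => 0 : R).
Proof. by split=> //; rewrite eseries0. Qed.

HB.instance Definition _ (R : realType) := gen_eqMixin (subprob R).
HB.instance Definition _ (R : realType) := gen_choiceMixin (subprob R).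
HB.instance Definition _ (R : realType) :=
  isPointed.Build (subprob R) (exist _ _ (is_subprob0 R)).

Definition cylinders (R : realType) : set (set (nat -> R)) :=
  \bigcup_(i : nat) preimage_set_system setT (fun p : nat -> R => p i) measurable.

Definition subprob_val (R : realType) (p : subprob R) :
  g_sigma_algebraType (@cylinders R) := sval p.

(* The trace on S of the product Borel sigma-algebra; the product may be taken
   over R or over [0, 1], since S is a subset of both powers. *)
HB.instance Definition _ (R : realType) :=
  Measurable.copy (subprob R) (g_sigma_algebra_preimageType (@subprob_val R)).

Definition l1_dist (R : realType) (p q : subprob R) : \bar R :=
  (\sum_(0 <= i <oo) `|sval p i - sval q i|%:E)%E.

Definition eps_equiv (R : realType) (eps : R) (E : set (subprob R * subprob R))
    : Prop :=
  discrete_equiv R E /\ forall p q, E (p, q) -> (l1_dist p q < eps%:E)%E.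

(* [A], restricted to the index set [N] (a finite initial segment of nat, or
   all of nat), enumerates [Q] without repetition. *)
Definition enumeration (Y : Type) (Q : set (set Y)) (N : set nat)
    (A : nat -> set Y) : Prop :=
  (N = setT \/ exists m, N = `I_m) /\ set_bij N Q A.

(* The sequence (P(x, A_i))_i, extended by zeros off [N]. *)
Definition block_probs d (X : measurableType d) (R : realType) (T : set X)
    (tp : target_problem R T) (N : set nat) (A : nat -> set X) (x : X) :
    nat -> R :=
  (fun i => fine (tp_prob tp x (A i))) \_ N.

(* A relation on S applied to two sequences that lie in S. *)
Definition rel_seq (R : realType) (E : set (subprob R * subprob R))
    (u v : nat -> R) : Prop :=
  exists p q : subprob R, [/\ sval p = u, sval q = v & E (p, q)].

Definition cond_mean d (Y : measurableType d) (R : realType)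
    (mu : probability Y R) (C : set Y) (g : Y -> \bar R) : \bar R :=
  (((fine (mu C))^-1)%:E * \int[mu]_(z in C) g z)%E.

(* [out n] is a possible output of stage n on the problem [tp], for the
   equivalences [sim n] (n >= 1) on S. The enumerations and the measure [mu]
   are chosen for the given problem. *)
Definition algorithm_run d (X : measurableType d) (R : realType) (T : set X)
    (sim : nat -> set (subprob R * subprob R)) (tp : target_problem R T)
    (out : nat -> target_problem R T) : Prop :=
  exists (E : nat -> set (X * X)) (N : nat -> set nat) (A : nat -> nat -> set X)
         (mu : probability
                 (g_sigma_algebraType (\bigcup_n tp_alg (out n))) R),
    [/\ E 0%N = [set xy | T xy.1 <-> T xy.2] /\
          tp_alg (out 0%N) = <<s [set T] >>,
        forall n, enumeration (quotient (E n)) (N n) (A n),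
        forall n,
          E n.+1 = [set xy | E n xy /\
                             rel_seq (sim n.+1)
                               (block_probs tp (N n) (A n) xy.1)
                               (block_probs tp (N n) (A n) xy.2)] /\
          tp_alg (out n.+1) = <<s quotient (E n.+1) >>,
        forall n B, tp_alg (out n) B -> B !=set0 -> (0 < mu B)%E &
        forall n x B, tp_alg (out n) B ->
          tp_prob (out n) x B =
            cond_mean mu (rel_class (E n) x) (fun z => tp_prob tp z B)].

Definition target_algorithm d (X : measurableType d) (R : realType)
    (T : set X) (Str : strategy R T) : Prop :=
  exists (eps : nat -> R) (sim : nat -> set (subprob R * subprob R)),
    [/\ forall n, 0 < eps n.+1,
        eps @ \oo --> (0 : R),
        forall n, eps_equiv (eps n.+1) (sim n.+1) &
        forall tp : target_problem R T,
          algorithm_run sim tp (fun n => Str n tp)].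

(* Main.v *)
(* The sigma-algebra F_n consists of the E_n-saturated sets, so it grows with n.
   Such a set B is a union of blocks of E_n, so if E_{n+1} (x, y) then P(x, B)
   and P(y, B) differ by at most the l1-distance of the block probabilities,
   hence by less than eps_{n+1}.  Averaging over the class of x gives (ii)
   without any martingale argument.

   For (i), code the countably many blocks of all stages by a ternary expansion:
   this is a random variable u, measurable for the join of the F_n, whose kernel
   is the intersection of the E_n.  By the estimate above and uniqueness of
   measures on a pi-system, ker u is a compatible projection, so ker u is
   contained in the optimal ker f, and (A0) turns this into
   sigma f <= sigma u <= join.  Conversely, by induction ker f is contained in
   every E_n: blocks of E_n are measurable ker f-saturated sets, hence by (A0)
   in sigma f, so P(x, .) and P(y, .) agree on them when f x = f y. *)
Require Import Defs.
From HB Require Import structures.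
From mathcomp Require Import all_boot all_order all_algebra.
From mathcomp Require Import all_classical all_reals all_analysis.
From mathcomp Require Import measurable_realfun ring lra.
Set Implicit Arguments.
Unset Strict Implicit.
Unset Printing Implicit Defensive.
Import Order.TTheory GRing.Theory Num.Theory.
Import numFieldNormedType.Exports.
Local Open Scope classical_set_scope.
Local Open Scope ring_scope.

(** * Coding of bit sequences by real numbers *)

Definition ternary_sum (R : realType) (b : nat -> bool) : \bar R :=
  (\sum_(0 <= k <oo) ((b k)%:R * 3^-1 ^+ k)%:E)%E.

(** Digits 0 and 1 in base 3, unlike base 2, never give one value to two sequences. Taking [fine]
    loses nothing, since the sum is finite. *)
Definition ternary_code (R : realType) (b : nat -> bool) : R :=
  fine (ternary_sum R b).

Lemma ternary_term_ge0 (R : realType) (b : bool) k :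
  (0 <= ((b%:R : R) * 3^-1 ^+ k)%:E)%E.
Proof. by rewrite lee_fin mulr_ge0// exprn_ge0// invr_ge0. Qed.

Lemma ternary_sum_ge0 (R : realType) b : (0 <= ternary_sum R b)%E.
Proof. by apply: nneseries_ge0 => k _ _; exact: ternary_term_ge0. Qed.

Lemma ternary_sum_le (R : realType) b : (ternary_sum R b <= (3 / 2)%:E)%E.
Proof.
apply: lime_le.
  by apply: is_cvg_nneseries => k _ _; exact: ternary_term_ge0.
apply: nearW => n; rewrite sumEFin lee_fin.
have third : `|3^-1 : R| < 1 by rewrite ger0_norm ?invr_ge0// invf_lt1//; lra.
(* The bound 3/2 is the sum of the geometric series of ratio 1/3, the case of all digits 1. *)
have -> : 3 / 2 = 1 * (1 - 3^-1)^-1 :> R by field.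
apply: le_trans (geometric_le_lim n ler01 _ third); last by rewrite invr_gt0.
rewrite /series/=; apply: ler_sum => k _.
by rewrite mul1r ler_piMl ?exprn_ge0 ?invr_ge0//; case: (b k).
Qed.

Lemma ternary_sum_fin_num (R : realType) b : ternary_sum R b \is a fin_num.
Proof.
rewrite ge0_fin_numE ?ternary_sum_ge0//.
by rewrite (le_lt_trans (ternary_sum_le R b))// ltry.
Qed.

Lemma ternary_codeS (R : realType) b :
  ternary_code R b = (b 0%N)%:R + 3^-1 * ternary_code R (fun k => b k.+1).
Proof.
apply: EFin_inj; rewrite EFinD EFinM /ternary_code.
rewrite !fineK ?ternary_sum_fin_num//.
rewrite {1}/ternary_sum nneseries_recl//.
rewrite expr0 mulr1 -nneseries_addn; last by move=> k; exact: ternary_term_ge0.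
rewrite -nneseriesZl; last by move=> k _; exact: ternary_term_ge0.
congr (_ + _)%E; apply: eq_eseriesr => k _.
by rewrite -EFinM addn1 exprS mulrCA.
Qed.

Lemma ternary_code_bounds (R : realType) b : 0 <= ternary_code R b <= 3 / 2.
Proof.
rewrite fine_ge0 ?ternary_sum_ge0//= -lee_fin fineK ?ternary_sum_fin_num//.
exact: ternary_sum_le.
Qed.

(* The tail of the expansion contributes at most 1/2, less than a leading 1. *)
Lemma ternary_code_inj (R : realType) : injective (ternary_code R).
Proof.
move=> b c bc; apply/funext => n.
elim: n b c bc => [|n IHn] b c; rewrite [LHS]ternary_codeS [RHS]ternary_codeS;
  have /andP[] := ternary_code_bounds R (fun k => b k.+1);
  have /andP[] := ternary_code_bounds R (fun k => c k.+1) => ? ? ? ?.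
  by case: (b 0%N) (c 0%N) => -[] //= ?; exfalso; lra.
move=> h; apply: (IHn (fun k => b k.+1) (fun k => c k.+1)).
by move: h; case: (b 0%N) (c 0%N) => -[] //= ?; lra.
Qed.

Lemma measurable_ternary_code (R : realType) d (Y : measurableType d)
    (B : nat -> set Y) : (forall k, measurable (B k)) ->
  measurable_fun setT (fun y => ternary_code R (fun k => `[< B k y >])).
Proof.
move=> mB; apply: measurableT_comp => //.
apply: ge0_emeasurable_sum => [k y _ _|k _]; first exact: ternary_term_ge0.
apply/measurable_EFinP; apply: measurable_funM => //.
rewrite (_ : (fun _ => _) = \1_(B k)); first exact: measurable_indic.
by apply/funext => y; rewrite indicE /mem/= /in_mem/=.
Qed.

(** * Saturated sets and enumerated partitions *)

Definition saturated (Y : Type) (E : set (Y * Y)) : set (set Y) :=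
  [set B | forall x y, E (x, y) -> B x -> B y].

(** Saturation is a one-way implication, so complements rely on the symmetry of the relation.
    Presenting relations as kernels supplies the equivalence axioms for free. *)
Lemma sigma_algebra_saturated (Y Z : Type) (h : Y -> Z) :
  sigma_algebra setT (saturated (ker_rel h)).
Proof.
split; first by [].
- by move=> B satB x y xy [_ nBx]; split=> // By; apply/nBx/(satB y).
- by move=> B satB x y xy [i _ Bx]; exists i => //; exact: (satB i x).
Qed.

Lemma rel_class_saturated (Y Z : Type) (h : Y -> Z) x :
  saturated (ker_rel h) (rel_class (ker_rel h) x).
Proof. by move=> y z; rewrite /rel_class/ker_rel/= => <-. Qed.

Lemma rel_class_sub (Y Z : Type) (h : Y -> Z) (B : set Y) x :
  saturated (ker_rel h) B -> B x -> rel_class (ker_rel h) x `<=` B.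
Proof. by move=> satB Bx y; move/satB; exact. Qed.

Section block.
Variables (Y Z : Type) (h : Y -> Z) (N : set nat) (A : nat -> set Y).
Hypothesis NA : enumeration (quotient (ker_rel h)) N A.

Lemma enumeration_class i x : N i -> A i x -> A i = rel_class (ker_rel h) x.
Proof.
move=> Ni Aix; case: NA => _ [funA _ _].
have [y _ yA] := funA i Ni; move: Aix; rewrite -yA /rel_class/ker_rel/= => hyx.
by apply/seteqP; split=> z /=; rewrite hyx.
Qed.

Lemma enumeration_cover x : exists2 i, N i & A i x.
Proof.
case: NA => _ [_ _ surjA].
have [|i Ni AiE] := surjA (rel_class (ker_rel h) x); first by exists x.
by exists i => //; rewrite AiE.
Qed.

Lemma enumeration_trivIset : trivIset N A.
Proof.
move=> i j Ni Nj [x [Aix Ajx]]; case: NA => _ [_ injA _].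
apply: injA; rewrite ?inE//.
by rewrite (enumeration_class Ni Aix) (enumeration_class Nj Ajx).
Qed.

Lemma saturated_bigcup B : saturated (ker_rel h) B ->
  B = \bigcup_(i in [set i | N i /\ A i `<=` B]) A i.
Proof.
move=> satB; apply/seteqP; split=> [x Bx|x [i [_ AB] /AB //]].
have [i Ni Aix] := enumeration_cover x; exists i => //; split=> //.
by rewrite (enumeration_class Ni Aix); exact: rel_class_sub.
Qed.

(** Countability of the blocks does the work: a saturated set is a countable union of blocks, with
    the empty set inserted at the remaining indices. *)
Lemma saturated_sub (F : set (set Y)) : sigma_algebra setT F ->
  (forall i, N i -> F (A i)) -> saturated (ker_rel h) `<=` F.
Proof.
move=> sF FA B satB; rewrite (saturated_bigcup satB) bigcup_mkcond.
case: sF => F0 _; apply => i; case: ifPn => //.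
by rewrite inE => -[/FA].
Qed.

Lemma sigma_quotient : <<s quotient (ker_rel h) >> = saturated (ker_rel h).
Proof.
apply/seteqP; split.
  apply: smallest_sub; first exact: sigma_algebra_saturated.
  by move=> _ [x _ <-]; exact: rel_class_saturated.
apply: saturated_sub; first exact: smallest_sigma_algebra.
move=> i Ni; apply: sub_sigma_algebra.
by case: NA => _ [+ _ _]; exact.
Qed.

End block.

Lemma saturated_set (Y : Type) (T : set Y) :
  saturated [set xy | T xy.1 <-> T xy.2] = <<s [set T] >>.
Proof.
apply/seteqP; split=> [B satB|]; last first.
  apply: smallest_sub.
    have -> : [set xy | T xy.1 <-> T xy.2] = ker_rel T.
      by apply/seteqP; split=> -[x y] /=; rewrite /ker_rel/= propeqE.
    exact: sigma_algebra_saturated.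
  by move=> _ -> x y [xy _].
have [sF0 sFC sFU] := smallest_sigma_algebra setT [set T].
have sT : <<s [set T] >> T by exact: sub_sigma_algebra.
have inT x : T x -> B x -> T `<=` B by move=> Tx Bx y Ty; apply: satB Bx.
have inTC x : ~ T x -> B x -> ~` T `<=` B by move=> Tx Bx y Ty; apply: satB Bx.
(* [B] is the union of those among [T] and its complement that meet it; every positive index repeats
   the complement. *)
pose C i := if i == 0%N then (if `[< T `&` B !=set0 >] then T else set0)
            else (if `[< ~` T `&` B !=set0 >] then ~` T else set0).
have -> : B = \bigcup_i C i.
  apply/seteqP; split=> [x Bx|x [i _]]; rewrite /C.
    have [Tx|nTx] := pselect (T x).
      by exists 0%N => //=; case: asboolP => // -[]; exists x.
    by exists 1%N => //=; case: asboolP => // -[]; exists x.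
  case: (i == 0%N); case: asboolP => //.
    by move=> [y [Ty By]]; exact: (inT y).
  by move=> [y [Ty By]]; exact: (inTC y).
apply: sFU => i; rewrite /C; case: (i == 0%N); case: asboolP => // _.
by rewrite -setTD; exact: sFC.
Qed.

(** * Measures of unions of blocks and the l1-distance *)

Lemma restrict_bigcup (Y : Type) (P : set nat) (A : nat -> set Y) :
  \bigcup_(i in P) A i = \bigcup_i [set y | P i /\ A i y].
Proof. by apply/seteqP; split=> [y [i Pi Ai]|y [i _ [Pi Ai]]]; exists i. Qed.

Lemma trivIset_restrict (Y : Type) (P N : set nat) (A : nat -> set Y) :
  P `<=` N -> trivIset N A -> trivIset setT (fun i => [set y | P i /\ A i y]).
Proof.
move=> PN tA i j _ _ [y [[Pi Ai] [Pj Aj]]].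
by apply: tA; [exact: PN|exact: PN|exists y].
Qed.

Lemma measurable_restrict_set d (Y : measurableType d) (P : Prop) (A : set Y) :
  (P -> measurable A) -> measurable [set y | P /\ A y].
Proof.
move=> mA; have [p|np] := pselect P.
  by rewrite (_ : [set _ | _] = A); [exact: mA|apply/seteqP; split=> y // []].
by rewrite (_ : [set _ | _] = set0)//; apply/seteqP; split=> y // [].
Qed.

Section prob_blocks.
Context d (Y : measurableType d) (R : realType).
Implicit Types m : {measure set Y -> \bar R}.
Variables (N : set nat) (A : nat -> set Y).
Hypotheses (mA : forall i, N i -> measurable (A i)) (tA : trivIset N A).

Let blocks m : nat -> R := (fun i => fine (m (A i))) \_ N.

(** Mass 1 is a hypothesis on a plain measure because the values of [tp_prob] are measures whose
    mass comes separately, from [prob_kernel]. *)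
Lemma prob_fin_num m B : m setT = 1%E -> measurable B -> m B \is a fin_num.
Proof.
move=> m1 mB; rewrite ge0_fin_numE//.
by rewrite (@le_lt_trans _ _ 1%E) ?ltry// -m1 le_measure ?inE.
Qed.

Lemma measure_bigcup_blocks m (P : set nat) : P `<=` N ->
  m (\bigcup_(i in P) A i) = (\sum_(0 <= i <oo) m [set y | P i /\ A i y])%E.
Proof.
(* Indices off [P] get the empty set, so that the union and the series both run over all of nat. *)
move=> PN; rewrite restrict_bigcup.
have mC i : measurable [set y | P i /\ A i y].
  by apply: measurable_restrict_set => /PN; exact: mA.
apply: measure_semi_bigcup => //; first exact: trivIset_restrict tA.
exact: bigcupT_measurable.
Qed.

Lemma blocksE m i : m setT = 1%E -> (blocks m i)%:E = m [set y | N i /\ A i y].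
Proof.
move=> m1; rewrite /blocks patchE; case: ifPn => [/set_mem Ni|/negP nNi].
  rewrite fineK; last by apply: prob_fin_num => //; exact: mA.
  by congr (m _); apply/seteqP; split=> y // [].
rewrite (_ : [set _ | _] = set0) ?measure0//.
by apply/seteqP; split=> y // [Ni]; case: nNi; rewrite inE.
Qed.

Lemma is_subprob_blocks m : m setT = 1%E -> is_subprob (blocks m).
Proof.
move=> m1; split=> [i|]; first by rewrite -lee_fin blocksE.
under eq_eseriesr => i _ do rewrite blocksE//.
rewrite -measure_bigcup_blocks// -m1 le_measure ?inE//.
exact: bigcup_measurable.
Qed.

(** The comparison is made block by block: on [P] each term grows by at most the matching term of
    the l1-distance, and off [P] the measures vanish. *)
Lemma le_measure_l1 m1 m2 (P : set nat) : m1 setT = 1%E -> m2 setT = 1%E ->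
  P `<=` N ->
  (m1 (\bigcup_(i in P) A i) <= m2 (\bigcup_(i in P) A i) +
     \sum_(0 <= i <oo) `|blocks m1 i - blocks m2 i|%:E)%E.
Proof.
move=> m11 m21 PN; rewrite !measure_bigcup_blocks// -nneseriesD//.
apply: lee_nneseries => // i _.
have [Pi|nPi] := pselect (P i); last first.
  by rewrite (_ : [set _ | _] = set0) ?measure0 ?add0e ?lee_fin//;
    apply/seteqP; split=> y // [].
have -> : [set y | P i /\ A i y] = [set y | N i /\ A i y].
  by apply/seteqP; split=> y [_ Ay]; split=> //; exact: PN.
rewrite -!blocksE// -EFinD lee_fin -lerBlDl.
exact: ler_norm.
Qed.

End prob_blocks.

(** * Bounds on averages over a class *)

Section cond_mean_bounds.
Context d (Y : measurableType d) (R : realType).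
Variables (mu : probability Y R) (C : set Y) (g : Y -> \bar R).
Hypotheses (mC : measurable C) (muC : (0 < mu C)%E).
Hypotheses (mg : measurable_fun setT g) (g0 : forall y, (0 <= g y)%E).

Let muC_fin : mu C \is a fin_num.
Proof. by apply: fin_num_measure. Qed.

Let fine_muC : 0 < fine (mu C).
Proof. by rewrite -lte_fin fineK. Qed.

Lemma cond_mean_le (c : R) : (forall y, C y -> (g y <= c%:E)%E) ->
  (cond_mean mu C g <= c%:E)%E.
Proof.
move=> gc; rewrite /cond_mean lee_pdivrMl// muleC -(fineK muC_fin) fineK//.
rewrite -(integral_cst mu mC); apply: ge0_le_integral => //.
exact: measurable_funTS.
Qed.

(** The error [e] stands on the right to avoid subtraction in the extended reals. *)
Lemma cond_mean_ge (c e : R) : 0 <= c -> 0 <= e ->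
  (forall y, C y -> (c%:E <= g y + e%:E)%E) ->
  (c%:E <= cond_mean mu C g + e%:E)%E.
Proof.
move=> c0 e0 gc; rewrite /cond_mean.
have mgC : measurable_fun C g by exact: measurable_funTS.
(* The constant [e] is its own average over [C], which reduces the claim to a comparison of
   integrals over [C]. *)
have -> : e%:E = ((fine (mu C))^-1%:E * (e%:E * mu C))%E.
  by rewrite -{2}(fineK muC_fin) -!EFinM mulrCA mulVf ?mulr1 ?gt_eqF.
rewrite -ge0_muleDr ?integral_ge0 ?mule_ge0//.
rewrite lee_pdivlMl// muleC fineK// -!(integral_cst mu mC) -ge0_integralD//.
by apply: ge0_le_integral => //; exact: emeasurable_funD.
Qed.

End cond_mean_bounds.

(** * Measurability of maps into S and of transition probabilities *)

Lemma measurable_fun_subprob d (Y : measurableType d) (R : realType)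
    (p : Y -> subprob R) :
  (forall i, measurable_fun setT (fun y => sval (p y) i)) ->
  measurable_fun setT p.
Proof.
(* The sigma-algebra of S is a trace of the product one, so preimages of cylinders suffice. *)
move=> mp; have mq : measurable_fun setT (@subprob_val R \o p).
  refine (@measurability _ _ Y (g_sigma_algebraType (@cylinders R)) setT
    (@subprob_val R \o p) (@cylinders R) _ _) => //.
  move=> _ [_ [i _ [B mB <-]] <-]; rewrite setTI setTI.
  by rewrite -[X in measurable X]setTI; exact: mp.
by move=> _ _ [B mB <-]; have := mq measurableT _ mB; rewrite !setTI.
Qed.

Lemma subprob_inj (R : realType) (p q : subprob R) : sval p = sval q -> p = q.
Proof.
case: p q => [u up] [v vp] /= uv; subst v; congr exist.
exact: Prop_irrelevance.
Qed.

Lemma tp_alg_measurableP d (X : measurableType d) (R : realType) (T : set X)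
    (tp : target_problem R T) (B : set X) :
  @measurable _ (g_sigma_algebraType (tp_alg tp)) B <-> tp_alg tp B.
Proof. by rewrite (measurable_g_measurableTypeE (tp_alg_sigma_algebra tp)). Qed.

Lemma tp_prob_preimage d (X : measurableType d) (R : realType) (T : set X)
    (tp : target_problem R T) (B : set X) (C : set (\bar R)) :
  tp_alg tp B -> measurable C ->
  tp_alg tp ((fun z => tp_prob tp z B) @^-1` C).
Proof.
move=> /tp_alg_measurableP mB mC; apply/tp_alg_measurableP.
by have := measurable_kernel (tp_prob tp) _ mB measurableT _ mC; rewrite setTI.
Qed.

(** * The successive partitions of the algorithm and their join *)

Section stages.
Context (R : realType) d (X : measurableType d) (T : set X).
Variables (tp : target_problem R T) (sim : nat -> set (subprob R * subprob R)).
Variables (E : nat -> set (X * X)) (N : nat -> set nat).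
Variable A : nat -> nat -> set X.
Hypothesis simP : forall n, discrete_equiv R (sim n.+1).
Hypothesis E0 : E 0%N = [set xy | T xy.1 <-> T xy.2].
Hypothesis NA : forall n, enumeration (quotient (E n)) (N n) (A n).
Hypothesis ES : forall n, E n.+1 =
  [set xy | E n xy /\ rel_seq (sim n.+1) (block_probs tp (N n) (A n) xy.1)
                                         (block_probs tp (N n) (A n) xy.2)].

Let XF := g_sigma_algebraType (tp_alg tp).

Let measurableXF : @measurable _ XF = tp_alg tp.
Proof. exact: measurable_g_measurableTypeE (tp_alg_sigma_algebra tp). Qed.

(** Both claims need one induction: measurability of the blocks of stage n puts their probabilities
    in S and makes them measurable in the point. The type [Z] is left free because each stage adds a
    real coordinate to [h]. *)
Lemma stage_ker n : exists (Z : Type) (h : X -> Z),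
  E n = ker_rel h /\ saturated (E n) `<=` tp_alg tp.
Proof.
elim: n => [|n [Z [h [Eh satE]]]].
  exists Prop, T; split.
    by rewrite E0; apply/seteqP; split=> -[x y] /=; rewrite /ker_rel/= propeqE.
  rewrite E0 saturated_set; apply: smallest_sub.
    exact: tp_alg_sigma_algebra.
  by move=> _ ->; exact: tp_alg_target.
have NAn := NA n; rewrite Eh in NAn.
have mA i : N n i -> @measurable _ XF (A n i).
  move=> Ni; rewrite measurableXF; apply: satE; rewrite Eh.
  by case: NAn => _ [/(_ i Ni) [x _ <-] _ _]; exact: rel_class_saturated.
have subA x : is_subprob (block_probs tp (N n) (A n) x).
  apply: (is_subprob_blocks mA (enumeration_trivIset NAn)).
  exact: prob_kernel.
pose p x : subprob R := exist _ _ (subA x).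
have [g [mg _ simE]] := simP n.
(* Here [g] is a discrete random variable on S with kernel [sim n.+1]. *)
have ESh : E n.+1 = ker_rel (fun x => (h x, g (p x))).
  rewrite ES simE Eh; apply/seteqP; split=> -[x y]; rewrite /ker_rel/=.
    move=> [-> [q [r [qx ry /= gqr]]]]; congr (_, _).
    have -> : p x = q by exact: subprob_inj.
    by have -> : p y = r by exact: subprob_inj.
  by move=> [hxy gxy]; split=> //; exists (p x), (p y).
exists (Z * R)%type, (fun x => (h x, g (p x))); split=> //.
have NAS := NA n.+1; rewrite ESh in NAS *.
apply: (saturated_sub NAS); first exact: tp_alg_sigma_algebra.
move=> i Ni; case: (NAS) => _ [/(_ i Ni) [x _ <-] _ _].
(* A new block is an old block cut by a level set of the coded block probabilities. *)
have -> : rel_class (ker_rel (fun x => (h x, g (p x)))) x =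
    rel_class (ker_rel h) x `&` (g \o p) @^-1` [set g (p x)].
  by apply/seteqP; split=> y; rewrite /rel_class/ker_rel/= => -[-> ->].
rewrite -measurableXF; apply: measurableI.
  by rewrite measurableXF; apply: satE; rewrite Eh; exact: rel_class_saturated.
have mp : @measurable_fun _ _ XF (subprob R) setT p.
  apply: measurable_fun_subprob => j /=; rewrite /block_probs.
  have [Nj|nNj] := pselect (N n j); last first.
    rewrite (_ : (fun _ => _) = cst 0)//.
    by apply/funext => y; rewrite patchE memNset.
  rewrite (_ : (fun _ => _) = fun y => fine (tp_prob tp y (A n j))); last first.
    by apply/funext => y; rewrite patchE mem_set.
  by apply: measurableT_comp => //; apply: measurable_kernel; exact: mA.
rewrite -[X in measurable X]setTI.
by apply: (measurableT_comp mg mp).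
Qed.

Lemma stage_saturated n : <<s quotient (E n) >> = saturated (E n).
Proof.
have [Z [h [Eh _]]] := stage_ker n.
by have := NA n; rewrite Eh => /sigma_quotient.
Qed.

Lemma stage_anti n : E n.+1 `<=` E n.
Proof. by rewrite ES => xy []. Qed.

Lemma stage_saturated_alg n : saturated (E n) `<=` tp_alg tp.
Proof. by have [Z [h []]] := stage_ker n. Qed.

Lemma stage_block n i : N n i -> saturated (E n) (A n i).
Proof.
have [Z [h [Eh _]]] := stage_ker n => Ni.
case: (NA n); rewrite Eh => _ [/(_ i Ni) [x _ <-] _ _].
exact: rel_class_saturated.
Qed.

Lemma stage_sym n x y : E n (x, y) -> E n (y, x).
Proof. by have [Z [h [-> _]]] := stage_ker n. Qed.

(** [B] is saturated one stage before the pair is related, because stage n+1 compares the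
    probabilities of the blocks of stage n. *)
Lemma stage_close n (e : R) x y B :
  (forall p q, sim n.+1 (p, q) -> (l1_dist p q < e%:E)%E) ->
  E n.+1 (x, y) -> saturated (E n) B ->
  (tp_prob tp x B <= tp_prob tp y B + e%:E)%E.
Proof.
move=> sime; rewrite ES /= => -[_ [p [q [px qy pq]]]] satB.
have [Z [h [Eh satE]]] := stage_ker n.
have NAn := NA n; rewrite Eh in NAn satB.
have mA i : N n i -> @measurable _ XF (A n i).
  by move=> Ni; rewrite measurableXF; apply: satE; exact: stage_block.
apply: le_trans (leeD (lexx _) (ltW (sime _ _ pq))).
rewrite /l1_dist px qy (saturated_bigcup NAn satB).
by apply: (le_measure_l1 mA (enumeration_trivIset NAn));
  [exact: prob_kernel|exact: prob_kernel|move=> i []].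
Qed.

Lemma stage_nested m n : (m <= n)%N -> E n `<=` E m.
Proof.
elim: n => [|n IHn]; first by rewrite leqn0 => /eqP ->.
rewrite leq_eqVlt => /predU1P[-> //|/IHn mn].
exact: subset_trans (stage_anti (n := n)) mn.
Qed.

Lemma stage_saturatedW m n : (m <= n)%N -> saturated (E m) `<=` saturated (E n).
Proof. by move=> mn B satB x y /(stage_nested mn); exact: satB. Qed.

Variable F : nat -> set (set X).
Hypothesis FE : forall n, F n = saturated (E n).

Let G := \bigcup_n F n.

Lemma stage_sub_alg : G `<=` tp_alg tp.
Proof. by move=> B [n _]; rewrite FE; exact: stage_saturated_alg. Qed.

Lemma stage_join_sub_alg : <<s G >> `<=` tp_alg tp.
Proof.
by apply: smallest_sub; [exact: tp_alg_sigma_algebra|exact: stage_sub_alg].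
Qed.

Lemma stage_join_code : exists u : X -> R,
  @measurable_fun _ _ (g_sigma_algebraType G) R setT u /\
  ker_rel u = \bigcap_n E n.
Proof.
(* Pairs (stage, index) are numbered by [pickle]; a number that codes no pair, or an index off [N],
   gives the empty set. *)
pose B k : set X := if unpickle k is Some ni then
  [set x | N ni.1 ni.2 /\ A ni.1 ni.2 x] else set0.
have mB k : @measurable _ (g_sigma_algebraType G) (B k).
  rewrite /B; case: (unpickle k) => [[n i]|//].
  apply: (@measurable_restrict_set _ (g_sigma_algebraType G)) => /= Ni.
  by apply: sub_sigma_algebra; exists n => //; rewrite FE; exact: stage_block.
exists (fun x => ternary_code R (fun k => `[< B k x >])); split.
  exact: measurable_ternary_code.
apply/seteqP; split=> -[x y]; rewrite /ker_rel/=.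
  move=> /ternary_code_inj xy n _; have [Z [h [Eh _]]] := stage_ker n.
  have NAn := NA n; rewrite Eh in NAn *.
  have [i Ni Aix] := enumeration_cover NAn x.
  (* The digit at the code of (n, i) tells whether a point lies in [A n i], the block of [x]. *)
  have := congr1 (@^~ (pickle (n, i))) xy; rewrite /= /B pickleK/= => xyB.
  have [_] : N n i /\ A n i y by apply/asboolP; rewrite -xyB; apply/asboolP.
  by rewrite (enumeration_class NAn Ni Aix).
move=> xy; congr ternary_code; apply/funext => k; apply: asbool_equiv_eq.
rewrite /B; case: (unpickle k) => [[n i]|//] /=.
split=> -[Ni Ai]; split=> //; apply: (stage_block Ni) Ai; first exact: xy.
by apply: stage_sym; exact: xy.
Qed.

Variable eps : nat -> R.
Hypothesis simE : forall n p q,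
  sim n.+1 (p, q) -> (l1_dist p q < (eps n.+1)%:E)%E.
Hypothesis eps0 : eps @ \oo --> (0 : R).

(** A set of [G] stays saturated at all later stages, where the error [eps] tends to 0; this gives
    an inequality, and symmetry the equality. *)
Lemma stage_join_eq x y B : (\bigcap_n E n) (x, y) -> <<s G >> B ->
  tp_prob tp x B = tp_prob tp y B.
Proof.
move=> xy; have GT : G setT by exists 0%N => //; rewrite FE.
have le_G u v C : (\bigcap_n E n) (u, v) -> G C ->
    (tp_prob tp u C <= tp_prob tp v C)%E.
  move=> uv [m _]; rewrite FE => satC; apply/lee_addgt0Pr => e e0.
  have [n _ eps_lt] := cvgr_lt _ eps0 _ e0.
  (* Stage m + n serves both ends: [C] is saturated there, and [eps] at m + n + 1 is below [e]. *)
  have mn : (m <= m + n)%N by exact: leq_addr.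
  apply: le_trans (stage_close (simE (n := m + n)) (uv _ I) _) _.
    exact: stage_saturatedW satC.
  rewrite leeD2l// lee_fin ltW// eps_lt//=.
  by rewrite -addSn leq_addl.
(* [G] is closed under intersections because the stages are nested; it contains the whole space,
   which acts as a constant exhausting sequence of finite measure. *)
apply: (@g_sigma_algebra_measure_unique _ R XF G _ (fun=> setT)) => //.
- by rewrite measurableXF; exact: stage_sub_alg.
- by rewrite bigcup_const.
- move=> C D [m _ +] [n _ +]; rewrite !FE => satC satD.
  exists (maxn m n) => //; rewrite FE => u v uv [Cu Du]; split.
    exact: (stage_saturatedW (leq_maxl m n) satC) uv Cu.
  exact: (stage_saturatedW (leq_maxr m n) satD) uv Du.
- move=> C GC; apply/eqP; rewrite eq_le !le_G// => n _.
  by apply: stage_sym; exact: xy.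
- by move=> _; rewrite prob_kernel ltry.
Qed.

End stages.

(** * Use of (A0), and the two claims *)

Lemma A0_saturated (R : realType) d (X : measurableType d) (f : X -> R)
    (B : set X) :
  A0 X R -> measurable_fun setT f -> measurable B -> saturated (ker_rel f) B ->
  sigma f B.
Proof.
(* The indicator of [B] is constant on the classes of [f], so (A0) applies to it, and [B] is its
   preimage of 1. *)
move=> hA0 mf mB satB; apply: (hA0 f \1_B) => //.
  move=> [x y] xy; rewrite /ker_rel/= !indicE; congr (_%:R).
  congr nat_of_bool; apply/idP/idP; rewrite !inE; first exact: satB xy.
  by apply: satB; rewrite /ker_rel/= -xy.
exists [set 1]; first exact: measurable_set1.
rewrite setTI; apply/seteqP; split=> x /=; rewrite indicE.
  by case: (boolP (x \in B)) => [/set_mem//|_ /eqP]; rewrite eq_sym oner_eq0.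
by move=> Bx; rewrite mem_set.
Qed.

Theorem theorem4 (R : realType) (d : measure_display) (X : measurableType d)
    (hA0 : A0 X R) (T : set X) (mT : measurable T)
    (tp : target_problem R T) (Str : strategy R T)
    (hStr : target_algorithm Str)
    (f : X -> R) (mf : measurable_fun setT f)
    (hopt : optimal_projection tp (ker_rel f)) :
  ((forall n, tp_alg (Str n tp) `<=` tp_alg (Str n.+1 tp)) /\
   <<s \bigcup_n tp_alg (Str n tp) >> = sigma f) /\
  (forall (x : X) (F : set X), (\bigcup_m tp_alg (Str m tp)) F ->
     tp_prob (Str n tp) x F @[n --> \oo] --> tp_prob tp x F).
Proof.
have [eps [sim [eps_gt0 eps0 simP run]]] := hStr.
have {run} [E [N [A [mu [[E0 alg0] NA ES_alg mu_gt0 PnE]]]]] := run tp.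
pose F n := tp_alg (Str n tp).
have simD n : discrete_equiv R (sim n.+1) by case: (simP n).
have simE n p q : sim n.+1 (p, q) -> (l1_dist p q < (eps n.+1)%:E)%E.
  by case: (simP n) => _; exact.
have ES n := (ES_alg n).1.
have FE n : F n = saturated (E n).
  case: n => [|n]; first by rewrite /F alg0 E0 saturated_set.
  by rewrite /F (ES_alg n).2 (stage_saturated simD E0 NA ES).
have F_mono n : F n `<=` F n.+1.
  by rewrite !FE; exact: (stage_saturatedW ES (leqnSn n)).
have [u [meas_u uE]] := stage_join_code simD E0 NA ES FE.
have joinX : <<s \bigcup_n F n >> `<=` measurable.
  apply: subset_trans (tp_alg_measurable (t := tp)).
  exact: (stage_join_sub_alg simD E0 NA ES FE).
(* (A0) speaks of functions measurable on [X] itself, hence the passage from the join to [X]. *)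
have measX_u : measurable_fun setT u.
  by move=> _ B mB; apply: joinX; exact: meas_u.
have sigma_u : sigma u `<=` <<s \bigcup_n F n >>.
  by move=> _ [B mB <-]; exact: meas_u.
have join_eq := stage_join_eq simD E0 NA ES FE simE eps0.
have [[g [mg fg sg Tg Pg]] maxf] := hopt.
(* The witness [g] of compatibility may differ from [f]; the two share their kernel, and (A0)
   transfers the sigma-algebra. *)
have sigma_fg : sigma f `<=` sigma g by apply: (hA0); rewrite // -fg.
have F_sub n : ker_rel f `<=` E n -> F n `<=` sigma f.
  rewrite FE => fE B satB; apply: A0_saturated => //.
    apply: (tp_alg_measurable (t := tp)).
    exact: (stage_saturated_alg simD E0 NA ES satB).
  by move=> x y /fE; exact: satB.
have f_E n : ker_rel f `<=` E n.
  elim: n => [|n IHn].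
    rewrite E0 => -[x y] /= xy; have [B _ <-] := Tg.
    by move: xy; rewrite fg /ker_rel/= => ->.
  move=> [x y] xy; have [Z [h [Eh _]]] := stage_ker simD E0 NA ES n.+1.
  (* Reflexivity already yields members of S related by [sim n.+1]; it remains to replace one copy
     of the sequence of [x] by the equal sequence of [y]. *)
  have : E n.+1 (x, x) by rewrite Eh.
  rewrite ES /= => -[_]; rewrite {2}(_ : block_probs _ _ _ x =
    block_probs tp (N n) (A n) y); first by split=> //; exact: IHn.
  apply/funext => i; rewrite /block_probs !patchE; case: ifPn => // /set_mem Ni.
  rewrite (Pg x y)//; apply/sigma_fg/(F_sub _ IHn); rewrite FE.
  exact: (stage_block simD E0 NA ES).
have sigma_f : <<s \bigcup_n F n >> = sigma f.
  apply/seteqP; split.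
    apply: smallest_sub; first exact: sigma_algebra_measurable
      (g_sigma_algebra_preimageType f).
    by move=> B [n _]; exact: (F_sub _ (f_E n)).
  (* Optimality of [ker_rel f] is used here, against the compatible projection [ker_rel u]. *)
  apply: (subset_trans _ sigma_u); apply: (hA0) => //; apply: maxf.
  exists u; split=> //.
  - apply: (subset_trans sigma_u).
    exact: (stage_join_sub_alg simD E0 NA ES FE).
  - apply: A0_saturated => //; rewrite uE => x y /(_ 0%N I); rewrite E0 /=.
    by case.
  - by move=> x y; rewrite uE => xy B /sigma_u; exact: join_eq.
split; first by split.
move=> x B [m _ FB].
have FnB n : (m <= n)%N -> F n B.
  by move=> mn; rewrite FE; apply: (stage_saturatedW ES mn); rewrite -FE.
have mB : tp_alg tp B by apply: (stage_sub_alg simD E0 NA ES FE); exists m.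
(* [P(z, B)] is constant on the classes of [u], so by (A0) its level sets lie in [sigma u], hence in
   the join on which [mu] lives. *)
have mPB : @measurable_fun _ _ (g_sigma_algebraType (\bigcup_n F n)) _ setT
    (fun z => tp_prob tp z B).
  move=> _ C mC; apply: sigma_u; rewrite setTI; apply: A0_saturated => //.
    by apply: (tp_alg_measurable (t := tp)); exact: tp_prob_preimage.
  rewrite uE => y z yz /=; rewrite (join_eq _ _ _ yz) //.
  by apply: sub_sigma_algebra; exists m.
have PxB : tp_prob tp x B \is a fin_num.
  apply: prob_fin_num; first exact: prob_kernel.
  exact/tp_alg_measurableP.
have [r rE] : exists r, tp_prob tp x B = r%:E.
  by exists (fine (tp_prob tp x B)); rewrite fineK.
have r0 : 0 <= r by rewrite -lee_fin -rE.
(* The averaged values are squeezed between r - eps_n and r + eps_n. *)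
apply: (@squeeze_cvge _ _ _ _ (fun n => (r - eps n)%:E) _
                                (fun n => (r + eps n)%:E)).
(* The estimate at stage n+1 needs [B] saturated at stage n, hence the start at m+1. *)
- exists m.+1 => // -[//|n] /= mn.
  have satB : saturated (E n) B by rewrite -FE; exact: FnB.
  rewrite PnE; last by apply: FnB; exact: leqW.
  have [Z [h [Eh _]]] := stage_ker simD E0 NA ES n.+1.
  have classF : F n.+1 (rel_class (E n.+1) x).
    by rewrite FE Eh; exact: rel_class_saturated.
  have mClass : @measurable _ (g_sigma_algebraType (\bigcup_n F n))
      (rel_class (E n.+1) x) by apply: sub_sigma_algebra; exists n.+1.
  have mu_class : (0 < mu (rel_class (E n.+1) x))%E.
    by apply: mu_gt0; [exact: classF|exists x; rewrite Eh].
  have e0 : 0 <= eps n.+1 by rewrite ltW.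
  rewrite EFinB leeBlDr//; apply/andP; split.
    apply: cond_mean_ge => // y xy; rewrite -rE.
    exact: (stage_close simD E0 NA ES (simE n) xy satB).
  apply: cond_mean_le => // y xy; rewrite EFinD -rE.
  apply: (stage_close simD E0 NA ES (simE n) _ satB).
  exact: (stage_sym simD E0 NA ES).
- rewrite rE -[r in X in _ --> X]subr0; apply: cvg_EFin; first exact: nearW.
  by apply: cvgB => //; exact: cvg_cst.
- rewrite rE -[r in X in _ --> X]addr0; apply: cvg_EFin; first exact: nearW.
  by apply: cvgD => //; exact: cvg_cst.
Qed.
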